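(* Let $(W_n)_{n\ge 1}$ and $(u_n)_{n\ge1}$ be respectively a nonnegative stochastic process and a deterministic sequence satisfying $$\varrho:=\sum_{n\ge1}\mathbb P[\log W_n<u_n]<+\infty .$$ Then $$\liminf_{n\to+\infty}\frac{\log W_n}{u_n}\ge 1\quad \mathbb P\text{-a.s.}\qquad\text{and}\qquad \mathbb E[\tau_\alpha]\le\varrho+\aleph\big((u_n)_{n\ge1},\log(1/\alpha)\big).$$
   Context: The process is defined on a probability space $(\Omega,\mathcal F,\mathbb P)$. For $\alpha\in(0,1)$, $\tau_\alpha:=\inf\{n\in\mathbb N : W_n\ge 1/\alpha\}\in\mathbb N\cup\{+\infty\}$ is the rejection time at level $\alpha$. For a real sequence $(u_n)_{n\ge1}$ and $x\in\mathbb R$, $\aleph((u_n)_{n\ge1},x):=\inf\{n\ge1:\inf_{k\ge n}u_k\ge x\}$ (with $\inf\emptyset=+\infty$).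
   Formalization: The liminf conclusion is stated under the added assumption that u_n > 0 for all large n, since it fails otherwise (W_n = 1, u_n = -1 gives ϱ = 0 but ratio 0); the bound on E[τ_α] is stated for every real sequence. *)

(* Defs.v *)
From HB Require Import structures.
From mathcomp Require Import all_boot all_order all_algebra.
From mathcomp Require Import all_classical all_reals all_analysis.

Set Implicit Arguments.
Unset Strict Implicit.
Unset Printing Implicit Defensive.

Import Order.TTheory GRing.Theory Num.Theory.
Import numFieldNormedType.Exports.

Local Open Scope classical_set_scope.
Local Open Scope ring_scope.
Local Open Scope ereal_scope.

(* Sequences start at index 1: the terms W 0 and u 0 are never used.
   Since W n w may vanish, its logarithm is the extended-real [lne],
   for which lne 0 = -oo. *)

(* +oo for the empty set *)
Definition inf_index (R : realType) (A : set nat) : \bar R :=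
  ereal_inf [set n%:R%:E | n in A].

Definition rejection_time (R : realType) (T : Type) (W : nat -> T -> R)
    (alpha : R) (w : T) : \bar R :=
  inf_index R [set n | (1 <= n)%N /\ (alpha^-1 <= W n w)%R].

(* [einfs v n] is the infimum of the v k for k >= n. *)
Definition aleph (R : realType) (u : nat -> R) (x : R) : \bar R :=
  inf_index R [set n | (1 <= n)%N /\ x%:E <= einfs (EFin \o u) n].

Definition varrho (d : measure_display) (T : measurableType d) (R : realType)
    (P : probability T R) (W : nat -> T -> R) (u : nat -> R) : \bar R :=
  \sum_(1 <= n <oo) P [set w | lne (W n w)%:E < (u n)%:E].

(* Main.v *)
Require Import Defs.
From HB Require Import structures.
From mathcomp Require Import all_boot all_order all_algebra.
From mathcomp Require Import all_classical all_reals all_analysis.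

(** Let A_n be the event log W_n < u_n, so that varrho is the sum of the
    P(A_n) over n >= 1.

    Almost sure bound.  As varrho is finite, the first Borel-Cantelli lemma
    [lim_sup_set_cvg0] says that almost surely only finitely many A_n occur;
    off this null set u_n <= log W_n for all large n, and dividing by u_n,
    which is eventually positive, gives a quotient that is eventually at
    least 1 ([limn_einf_ge]).

    Bound on the expectation.  The tail-sum formula [integral_inf_index]
    writes E[tau] as the sum over n >= 0 of P(tau > n).  Suppose that aleph is
    finite, say equal to N >= 1, so that log(1/alpha) <= u_n for all n >= N.
    If tau > n, then W_n < 1/alpha, hence for n >= N
    log W_n < log(1/alpha) <= u_n, that is, A_n occurs.  The terms with n < N
    are at most 1 and add up to at most N; the other ones are at most P(A_n)
    and add up to at most varrho. *)

Import Order.TTheory GRing.Theory Num.Theory.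
Import numFieldNormedType.Exports.

Local Open Scope classical_set_scope.
Local Open Scope ring_scope.
Local Open Scope ereal_scope.

Lemma inf_indexP (R : realType) (A : set nat) :
  (A = set0 /\ inf_index R A = +oo) \/
  exists m : nat, [/\ A m, forall k, A k -> (m <= k)%N
                    & inf_index R A = m%:R%:E].
Proof.
have [->|/set0P[n0 An0]] := eqVneq A set0.
  by left; split=> //; rewrite /inf_index image_set0 ereal_inf0.
have exA : exists n, `[< A n >] by exists n0; apply/asboolP.
right; case: (ex_minnP exA) => m /asboolP Am minm.
have {}minm k : A k -> (m <= k)%N by move=> Ak; apply: minm; apply/asboolP.
exists m; split=> //; apply/eqP; rewrite eq_le; apply/andP; split.
  by apply: ereal_inf_lbound; exists m.
by apply: le_ereal_inf_tmp => _ [k Ak <-]; rewrite lee_fin ler_nat minm.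
Qed.

(** An extended natural number is the number of naturals n below it, and n is
    below the infimum of A exactly when A misses {0, ..., n}. *)
Lemma inf_index_tail_sum (R : realType) (A : set nat) :
  inf_index R A =
    \sum_(0 <= n <oo) (\1_[set n | forall k, (k <= n)%N -> ~ A k] n : R)%:E.
Proof.
set D := [set n | _].
have indD0 n : 0 <= (\1_D n : R)%:E by rewrite lee_fin.
have sum1 m : {in [pred i | (i < m)%N], forall i, D i} ->
    \sum_(0 <= i < m) (\1_D i : R)%:E = m%:R%:E.
  move=> Dm; rewrite (eq_big_nat _ _ (F2 := fun=> (1%R : R)%:E)).
    by rewrite sumEFin sumr_const_nat subn0.
  by move=> i /andP[_ im]; rewrite indicE mem_set//; exact: Dm.
have [[A0 ->]|[m [Am minm ->]]] := inf_indexP R A.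
  apply/esym/eqyP => r _.
  have [m rm] : exists m : nat, (r <= m%:R)%R.
    exists (Num.truncn `|r|).+1.
    exact/ltW/(le_lt_trans (ler_norm r))/truncnS_gt.
  apply: (@le_trans _ _ m%:R%:E); first by rewrite lee_fin.
  rewrite -sum1; last by move=> i _ k _; rewrite A0.
  exact: nneseries_lim_ge.
rewrite (@nneseries_split _ _ 0%N m)// add0n sum1; last first.
  by move=> i im k ki /minm; rewrite leqNgt (leq_ltn_trans ki im).
rewrite eseries0 ?adde0// => i mi _; rewrite indicE memNset//.
by move=> /(_ _ mi).
Qed.

(** Tail-sum formula for a first entrance time: its expansion into
    indicators is integrated term by term, by monotone convergence. *)
Lemma integral_inf_index (d : measure_display) (T : measurableType d)
    (R : realType) (mu : {measure set T -> \bar R}) (E : nat -> set T) :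
  (forall n, measurable (E n)) ->
  \int[mu]_w inf_index R [set n | E n w] =
    \sum_(0 <= n <oo) mu (\bigcap_(k in [set k | (k <= n)%N]) ~` E k).
Proof.
move=> mE.
have mD n : measurable (\bigcap_(k in [set k | (k <= n)%N]) ~` E k).
  by apply: bigcap_measurableType => k _; exact: measurableC.
under eq_integral do rewrite inf_index_tail_sum.
rewrite integral_nneseries//.
- apply: eq_eseriesr => n _.
  by rewrite -[X in mu X]setIT -integral_indic.
- move=> n; apply/measurable_realfun.measurable_EFinP.
  exact: (measurable_realfun.measurable_indic (mD n)).
Qed.

(** Valid for every real x, because [lne] is -oo on the nonpositive reals. *)
Lemma lne_lt_fin (R : realType) (x y : R) :
  (lne x%:E < y%:E) = (x < expR y)%R.
Proof.
have [x0|x0] := leP x 0%R.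
  by rewrite le0_lneNy// ltNyr (le_lt_trans x0)// expR_gt0.
by rewrite lne_EFin// lte_fin -[in RHS](lnK x0) ltr_expR.
Qed.

Lemma limn_einf_ge (R : realType) (v : (\bar R)^nat) (c : \bar R) :
  (\forall n \near \oo, c <= v n) -> c <= limn_einf v.
Proof.
move=> [N _ cv]; rewrite limn_einf_lim; apply: lime_ge.
  exact: is_cvg_einfs.
exists N => //= n Nn; apply: le_ereal_inf_tmp => _ [k /= nk <-].
by apply: cv; exact: leq_trans nk.
Qed.

Lemma measurable_rv_lt (d : measure_display) (T : measurableType d)
    (R : realType) (P : probability T R) (X : {RV P >-> R}) (a : R) :
  measurable [set w | (X w < a)%R].
Proof.
rewrite [X in measurable X](_ : _ = X @^-1` `]-oo, a[); last first.
  by apply/seteqP; split => w /=; rewrite in_itv.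
by rewrite -[X in measurable X]setTI; exact: measurable_funP.
Qed.

(* Eventual positivity of u is required for the first conclusion only: with
   u = -1 and W = 1 one has varrho = 0 while (log W_n) / u_n = 0 < 1. *)
Theorem lemma1p1 (d : measure_display) (T : measurableType d) (R : realType)
    (P : probability T R) (W : nat -> {RV P >-> R}) (u : nat -> R)
    (W_ge0 : forall n w, (1 <= n)%N -> (0 <= W n w)%R)
    (varrho_fin : varrho P W u < +oo) :
  ((\forall n \near \oo, (0 < u n)%R) ->
     {ae P, forall w,
        1 <= limn_einf (fun n => lne (W n w)%:E / (u n)%:E)}) /\
  (forall alpha : R, (0 < alpha < 1)%R ->
     \int[P]_w rejection_time W alpha w
       <= varrho P W u + aleph u (ln alpha^-1)).
Proof.
pose A n := [set w | lne (W n w)%:E < (u n)%:E].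
have mA n : measurable (A n).
  rewrite /A; under eq_set do rewrite lne_lt_fin.
  exact: measurable_rv_lt.
split=> [u_gt0|alpha /andP[alpha0 _]].
  (* [lim_sup_set_cvg0] sums from 0; the extra P (A 0) is at most 1. *)
  have sumA_fin : \sum_(0 <= n <oo) P (A n) < +oo.
    rewrite nneseries_recl// lte_add_pinfty//.
    by rewrite (le_lt_trans (probability_le1 _ _))// ltry.
  exists (lim_sup_set A); split.
  - apply: bigcap_measurableType => n _.
    exact: bigcup_measurable.
  - exact: lim_sup_set_cvg0.
  - move=> w /= nlim; apply: contrapT => nsup; apply: nlim.
    have /existsNP[N nA] :
        ~ forall n, True -> (\bigcup_(j in [set j | (n <= j)%N]) A j) w.
      exact: nsup.
    have {}nA n : (N <= n)%N -> (u n)%:E <= lne (W n w)%:E.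
      by move=> Nn; rewrite leNgt; apply/negP => An; apply: nA => _; exists n.
    apply: limn_einf_ge; near=> n.
    have un : (0 < u n)%R by near: n.
    rewrite inver gt_eqF// lee_pdivlMr// mul1e nA//.
    by near: n; exact: nbhs_infty_ge.
rewrite /aleph.
have [[_ ->]|[N [[N1 uN] _ ->]]] :=
    inf_indexP R [set n | (1 <= n)%N /\ (ln alpha^-1)%:E <= einfs (EFin \o u) n].
  rewrite addey ?leey//.
  rewrite gt_eqF// (lt_le_trans (ltNyr 0))//.
  exact: nneseries_ge0.
have {}uN n : (N <= n)%N -> (ln alpha^-1 <= u n)%R.
  move=> Nn; rewrite -lee_fin (le_trans uN)//.
  by apply: ereal_inf_lbound; exists n.
pose E n := [set w | (1 <= n)%N /\ (alpha^-1 <= W n w)%R].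
have mE n : measurable (E n).
  case: n => [|n]; first by rewrite (_ : E 0%N = set0)// -subset0 => w [].
  rewrite (_ : E n.+1 = ~` [set w | (W n.+1 w < alpha^-1)%R]).
    exact/measurableC/measurable_rv_lt.
  apply/seteqP; split=> w /=; first by move=> [_ aW]; apply/negP; rewrite -leNgt.
  by move/negP; rewrite -leNgt.
pose B n := \bigcap_(k in [set k | (k <= n)%N]) ~` E k.
rewrite (integral_inf_index _ _ _ P E mE) -[leLHS]/(\sum_(0 <= n <oo) P (B n)).
have mB n : measurable (B n).
  by apply: bigcap_measurableType => k _; exact: measurableC.
have BA n : (N <= n)%N -> B n `<=` A n.
  move=> Nn w /(_ n (leqnn n)) /= nE.
  have Wa : (W n w < alpha^-1)%R.
    rewrite ltNge; apply/negP => aW; apply: nE; split=> //.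
    exact: leq_trans Nn.
  rewrite /A /= lne_lt_fin (lt_le_trans Wa)// -[leLHS]lnK ?ler_expR ?uN//.
  by rewrite posrE invr_gt0.
(* The tail n >= N is bounded by varrho, the first N terms by N. *)
rewrite (nneseries_split 0 N)// add0n addeC; apply: leeD.
  apply: (@le_trans _ _ (\sum_(N <= n <oo) P (A n))).
    rewrite !(ereal_series _ N); apply: lee_nneseries => // n Nn.
    by apply: le_measure; rewrite ?inE//; exact: BA.
  by rewrite /varrho (nneseries_split 1 N.-1)// add1n prednK// leeDr// sume_ge0.
rewrite (_ : N%:R%:E = \sum_(0 <= n < N) (1%R : R)%:E).
  by apply: lee_sum => n _; exact: probability_le1.
by rewrite sumEFin sumr_const_nat subn0.
Unshelve. all: by end_near. Qed.
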